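(* Let $G$ be an oligomorphic closed subgroup of $\mathrm{Sym}(\omega)$, and let $\mathcal N_G$ denote the normaliser of $G$ in $\mathrm{Sym}(\omega)$. Then: (a) $\mathrm{Inn}(G)$ is closed in $\mathrm{Aut}(G)$. (b) The Polish group $\mathcal N_G/G$ is profinite. (c) The Polish group $\mathrm{Out}(G)=\mathrm{Aut}(G)/\mathrm{Inn}(G)$ is totally disconnected and locally compact.
   Context: $\mathrm{Sym}(\omega)$ is the Polish group of permutations of $\omega$; a neighbourhood basis of $1$ is given by the pointwise stabilisers of finite sets. A subgroup $G\leq\mathrm{Sym}(\omega)$ is oligomorphic if for each $n$ the canonical action of $G$ on $\omega^n$ has only finitely many orbits. $\mathrm{Aut}(G)$ denotes the group of continuous automorphisms of $G$. It carries the (Polish, non-Archimedean) group topology for which a neighbourhood basis of the identity consists of the subgroups $\{\Phi\in\mathrm{Aut}(G): \Phi(A_i)=A_i \text{ for } i=1,\dots,n\}$, where $A_1,\dots,A_n$ are cosets of open subgroups of $G$. $\mathrm{Inn}(G)$ is the group of inner automorphisms of $G$. The quotients $\mathcal N_G/G$ (with $\mathcal N_G$ carrying the subspace topology from $\mathrm{Sym}(\omega)$) and $\mathrm{Out}(G)$ carry the quotient topology. *)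

(* Defs.v *)
From HB Require Import structures.
From mathcomp Require Import all_boot all_order all_algebra.
From mathcomp Require Import all_classical all_reals all_analysis.

Set Implicit Arguments.
Unset Strict Implicit.
Unset Printing Implicit Defensive.

Local Open Scope classical_set_scope.
Local Open Scope quotient_scope.
Local Open Scope group_scope.

HB.mixin Record isTopologicalGroup T of Group T & Topological T := {
  mulg_continuous : continuous (fun x : T * T => x.1 * x.2) ;
  invg_continuous : continuous (fun x : T => x^-1)
}.

#[short(type="topologicalGroupType")]
HB.structure Definition TopologicalGroup :=
  {T of Group T & Topological T & isTopologicalGroup T}.

(* The group topology with a prescribed neighbourhood basis of the identity
   consisting of subgroups: a neighbourhood of g is a set containing g V for
   some V in the basis. *)
HB.factory Record isSubgroupTopological T of Group T := {
  nbhs1_base : set_system T ;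
  nbhs1_base_neq0 : nbhs1_base !=set0 ;
  nbhs1_base1 : forall V, nbhs1_base V -> V 1 ;
  nbhs1_baseM : forall V, nbhs1_base V -> forall x y, V x -> V y -> V (x * y) ;
  nbhs1_baseV : forall V, nbhs1_base V -> forall x, V x -> V x^-1 ;
  nbhs1_baseI : forall V W, nbhs1_base V -> nbhs1_base W ->
    exists2 U, nbhs1_base U & U `<=` V `&` W ;
  nbhs1_baseJ : forall V g, nbhs1_base V ->
    exists2 U, nbhs1_base U & forall x, U x -> V (x ^ g)
}.

HB.builders Context T of isSubgroupTopological T.

Definition nbhs_of (g : T) : set_system T :=
  [set A | exists2 V, nbhs1_base V & forall x, V x -> A (g * x)].

HB.instance Definition _ := hasNbhs.Build T nbhs_of.

Let nbhsP (g : T) (A : set T) :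
  nbhs g A = exists2 V, nbhs1_base V & forall x, V x -> A (g * x).
Proof. by []. Qed.

Let nbhs_filter_subproof (g : T) : ProperFilter (nbhs g).
Proof.
apply: Build_ProperFilter_ex => [A|].
  by rewrite nbhsP => -[V bV VA]; exists (g * 1); apply: VA; exact: nbhs1_base1.
split.
- by have [V bV] := nbhs1_base_neq0; rewrite nbhsP; exists V.
- move=> A B; rewrite !nbhsP => -[V bV VA] [W bW WB].
  have [U bU UVW] := nbhs1_baseI bV bW.
  by exists U => // x /UVW[Vx Wx]; split; [exact: VA|exact: WB].
- move=> A B AB; rewrite !nbhsP => -[V bV VA].
  by exists V => // x /VA/AB.
Qed.

Let nbhs_singleton_subproof (g : T) (A : set T) : nbhs g A -> A g.
Proof.
rewrite nbhsP => -[V bV VA]; rewrite -[g]mulg1; apply: VA.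
exact: nbhs1_base1.
Qed.

Let nbhs_nbhs_subproof (g : T) (A : set T) :
  nbhs g A -> nbhs g (nbhs^~ A).
Proof.
rewrite !nbhsP => -[V bV VA]; exists V => // x Vx.
rewrite nbhsP; exists V => // y Vy; rewrite -mulgA; apply: VA.
exact: (nbhs1_baseM bV).
Qed.

HB.instance Definition _ := Nbhs_isNbhsTopological.Build T
  nbhs_filter_subproof nbhs_singleton_subproof nbhs_nbhs_subproof.

Let mulg_continuous_subproof : continuous (fun x : T * T => x.1 * x.2).
Proof.
move=> [g h] A; rewrite nbhs_simpl /= nbhsP => -[V bV VA].
have [U bU UV] := nbhs1_baseJ h bV.
exists ([set g * x | x in U], [set h * x | x in V]) => /=.
  by split; rewrite nbhsP; [exists U|exists V] => // x Ux; exists x.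
move=> [a b] /= [[x Ux xa] [y Vy yb]]; rewrite -xa -yb /=.
have -> : g * x * (h * y) = g * h * (x ^ h * y).
  by rewrite conjgE !mulgA mulgK.
by apply: VA; apply: (nbhs1_baseM bV) => //; exact: UV.
Qed.

Let invg_continuous_subproof : continuous (fun x : T => x^-1).
Proof.
move=> g A; rewrite nbhs_simpl /= nbhsP => -[V bV VA].
have [U bU UV] := nbhs1_baseJ g^-1 bV.
rewrite nbhsP; exists U => // x Ux /=.
have -> : (g * x)^-1 = g^-1 * (x^-1 ^ g^-1).
  by rewrite conjgE invgK !mulgA mulVg mul1g invgM.
by apply: VA; rewrite conjVg; apply: (nbhs1_baseV bV); exact: UV.
Qed.

HB.instance Definition _ := isTopologicalGroup.Build T
  mulg_continuous_subproof invg_continuous_subproof.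

HB.end.

Record subgroup (T : groupType) := Subgroup {
  sg_set :> set T ;
  sg_closed : group_closed [in sg_set]
}.

Record normal_subgroup (T : groupType) := NormalSubgroup {
  nsg_group :> subgroup T ;
  nsg_normal : forall x g : T, sg_set nsg_group x -> sg_set nsg_group (x ^ g)
}.

Section subgroup_lemmas.
Context {T : groupType}.
Implicit Type H : subgroup T.

Lemma sg1 H : sg_set H 1.
Proof. by case: H => H [h1 _] /=; exact: set_mem. Qed.

Lemma sgF H x y : sg_set H x -> sg_set H y -> sg_set H (x / y).
Proof.
case: H => H [_ hF] /= Hx Hy; apply: set_mem.
by apply: hF; exact: mem_set.
Qed.

Lemma sgV H x : sg_set H x -> sg_set H x^-1.
Proof. by move=> Hx; rewrite -div1g; apply: sgF => //; exact: sg1. Qed.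

Lemma sgM H x y : sg_set H x -> sg_set H y -> sg_set H (x * y).
Proof. by move=> Hx Hy; rewrite -[y]invgK; apply/sgF/sgV. Qed.

Lemma set_group_closed (A : set T) :
  A 1 -> (forall x y, A x -> A y -> A (x / y)) -> group_closed [in A].
Proof.
move=> A1 AF; split=> [|x y]; first exact: mem_set.
by move=> /set_mem Ax /set_mem Ay; apply/mem_set/AF.
Qed.

End subgroup_lemmas.

HB.instance Definition _ (T : groupType) (H : subgroup T) :=
  SubChoice.copy (set_type (sg_set H)) {x : T | x \in sg_set H}.
HB.instance Definition _ (T : groupType) (H : subgroup T) :=
  SubChoice_isSubGroup.Build T [in sg_set H] (set_type (sg_set H))
    (sg_closed H).

Section subgroup_topology.
Context {T : topologicalGroupType} (H : subgroup T).
Let S := set_type (sg_set H).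

Let val_continuous : continuous (val : S -> T).
Proof. exact: initial_continuous. Qed.

Let subgroup_mulg_continuous : continuous (fun x : S * S => x.1 * x.2).
Proof.
have cval : continuous (fun x : S * S => val x.1 * val x.2 : T).
  move=> x; apply: (@continuous2_cvg _ _ _ _ _ _ _ _ (fun x y : T => x * y)).
  - exact: (@mulg_continuous T (val x.1, val x.2)).
  - by apply: continuous_comp; [exact: cvg_fst|exact: val_continuous].
  - by apply: continuous_comp; [exact: cvg_snd|exact: val_continuous].
apply/continuousP => _ [A oA <-].
by move/continuousP : cval => /(_ A oA).
Qed.

Let subgroup_invg_continuous : continuous (fun x : S => x^-1).
Proof.
apply/continuousP => _ [A oA <-]; exists ((fun x => x^-1) @^-1` A).
  by move: A oA; apply/continuousP/invg_continuous.
by [].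
Qed.

HB.instance Definition _ := isTopologicalGroup.Build (set_type (sg_set H))
  subgroup_mulg_continuous subgroup_invg_continuous.
End subgroup_topology.

Section quotient_group.
Context {T : topologicalGroupType} (N : normal_subgroup T).

Definition coset_rel : rel T := fun x y => (x^-1 * y) \in (N : set T).

Let coset_rel_refl : reflexive coset_rel.
Proof. by move=> x; rewrite /coset_rel mulVg; exact/mem_set/sg1. Qed.

Let coset_rel_sym : symmetric coset_rel.
Proof.
suff h x y : coset_rel x y -> coset_rel y x.
  by move=> x y; apply/idP/idP; exact: h.
by move=> /set_mem/sgV; rewrite invgM invgK => ?; exact: mem_set.
Qed.

Let coset_rel_trans : transitive coset_rel.
Proof.
move=> y x z /set_mem xy /set_mem yz; apply: mem_set.
by have := sgM xy yz; rewrite mulgA mulgK.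
Qed.

Canonical coset_equiv :=
  EquivRel coset_rel coset_rel_refl coset_rel_sym coset_rel_trans.

Definition quotient_group := quotient_topology {eq_quot coset_equiv}.

HB.instance Definition _ := Quotient.on quotient_group.
HB.instance Definition _ := Topological.on quotient_group.

Definition to_coset (x : T) : quotient_group := \pi x.

Lemma cosetP x y : to_coset x = to_coset y <-> sg_set N (x^-1 * y).
Proof.
split=> [/eqmodP/set_mem//|Nxy]; apply/eqmodP; exact/mem_set.
Qed.

Lemma coset_repr (a : quotient_group) : to_coset (repr a) = a.
Proof. exact: reprK. Qed.

Let mul (a b : quotient_group) := to_coset (repr a * repr b).
Let inv (a : quotient_group) := to_coset (repr a)^-1.

Let cosetM x y : mul (to_coset x) (to_coset y) = to_coset (x * y).
Proof.
have /cosetP Nx := coset_repr (to_coset x).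
have /cosetP Ny := coset_repr (to_coset y).
apply/cosetP; move: (repr (to_coset x)) (repr (to_coset y)) Nx Ny => a b Nx Ny.
have -> : (a * b)^-1 * (x * y) = (a^-1 * x) ^ b * (b^-1 * y).
  by rewrite conjgE invgM !mulgA mulgK.
by apply: sgM => //; exact: nsg_normal.
Qed.

Let cosetV x : inv (to_coset x) = to_coset x^-1.
Proof.
have /cosetP Nx := coset_repr (to_coset x).
apply/cosetP; move: (repr _) Nx => a Nx; rewrite invgK.
have -> : a * x^-1 = (a^-1 * x)^-1 ^ a^-1.
  by rewrite conjgE invgM !invgK !mulgA mulgK.
by apply: nsg_normal; exact: sgV.
Qed.

Let qmulA : associative mul.
Proof.
move=> a b c; rewrite -(coset_repr a) -(coset_repr b) -(coset_repr c).
by rewrite !cosetM mulgA.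
Qed.

Let qmul1 : left_id (to_coset 1) mul.
Proof. by move=> a; rewrite -(coset_repr a) cosetM mul1g. Qed.

Let qmulg1 : right_id (to_coset 1) mul.
Proof. by move=> a; rewrite -(coset_repr a) cosetM mulg1. Qed.

Let qmulV : left_inverse (to_coset 1) inv mul.
Proof. by move=> a; rewrite -(coset_repr a) cosetV cosetM mulVg. Qed.

Let qmulgV : right_inverse (to_coset 1) inv mul.
Proof. by move=> a; rewrite -(coset_repr a) cosetV cosetM mulgV. Qed.

HB.instance Definition _ := isGroup.Build quotient_group
  qmulA qmul1 qmulg1 qmulV qmulgV.

Lemma coset_mulg x y : to_coset (x * y) = to_coset x * to_coset y.
Proof. by rewrite -cosetM. Qed.

Lemma coset_invg x : to_coset x^-1 = (to_coset x)^-1.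
Proof. by rewrite -cosetV. Qed.

Lemma coset_continuous : continuous to_coset.
Proof. exact: pi_continuous. Qed.

Lemma coset_nbhs (x : T) (U : set T) :
  nbhs x U -> nbhs (to_coset x) (to_coset @` U).
Proof.
rewrite nbhsE => -[V [oV Vx] VU]; rewrite nbhsE.
exists (to_coset @` V); last by move=> _ [y Vy <-]; exists y => //; exact: VU.
split; last by exists x.
have -> : open (to_coset @` V) = open (to_coset @^-1` (to_coset @` V)) by [].
rewrite (_ : _ @^-1` _ = \bigcup_(n in sg_set N) ((fun y => y * n) @^-1` V)).
  apply: bigcup_open => n _; move: V oV {Vx VU}; apply/continuousP => y.
  apply: (@continuous2_cvg _ _ _ _ _ _ _ _ (fun x y : T => x * y)).
  - exact: (@mulg_continuous T (y, n)).
  - exact: cvg_id.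
  - exact: cvg_cst.
apply/seteqP; split=> [y [z Vz /esym/cosetP Nyz]|y [n Nn Vyn]] /=.
  by exists (y^-1 * z) => //=; rewrite mulVKg.
by exists (y * n) => //; apply/esym/cosetP; rewrite mulKg.
Qed.

Let quotient_mulg_continuous :
  continuous (fun x : quotient_group * quotient_group => x.1 * x.2).
Proof.
move=> [a b] A; rewrite -(coset_repr a) -(coset_repr b) /= -coset_mulg.
move=> /coset_continuous/(@mulg_continuous T (repr a, repr b)).
case=> -[U V] /= [Ua Vb] UVA.
exists (to_coset @` U, to_coset @` V); first by split; exact: coset_nbhs.
move=> [c d] /= [[x Ux xc] [y Vy yd]]; rewrite -xc -yd -coset_mulg.
exact: (UVA (x, y)).
Qed.

Let quotient_invg_continuous : continuous (fun x : quotient_group => x^-1).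
Proof.
move=> a A; rewrite -(coset_repr a) -coset_invg.
move=> /coset_continuous/invg_continuous Aa.
apply: filterS (coset_nbhs Aa) => b [x Ax xb] /=.
by rewrite -xb -coset_invg.
Qed.

HB.instance Definition _ := isTopologicalGroup.Build quotient_group
  quotient_mulg_continuous quotient_invg_continuous.
End quotient_group.

Section normaliser.
Context {T : groupType} (G : subgroup T).

Definition normaliser_set : set T :=
  [set h | [set g ^ h | g in sg_set G] = sg_set G].

Let normaliser_closed : group_closed [in normaliser_set].
Proof.
apply: set_group_closed => [|h k hG kG].
  rewrite /normaliser_set /= -[RHS]image_id.
  by apply: eq_imagel => g _; rewrite conjg1.
rewrite /normaliser_set /=.
transitivity ([set g ^ k^-1 | g in [set g ^ h | g in sg_set G]]).
  by rewrite image_comp; apply: eq_imagel => g _ /=; rewrite conjgM.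
rewrite hG -[X in _ @` X]kG image_comp -[RHS]image_id.
by apply: eq_imagel => g _ /=; rewrite conjgK.
Qed.

Definition normaliser : subgroup T := Subgroup normaliser_closed.
End normaliser.

(* G as a normal subgroup of (the group of elements of) its normaliser. *)
Section subgroup_of_normaliser.
Context {T : groupType} (G : subgroup T).

Let in_normaliser_closed :
  group_closed [in [set x : normaliser G | sg_set G (val x)]].
Proof.
apply: set_group_closed => [|x y Gx Gy]; first exact: sg1.
exact: (@sgF _ G (val x) (val y)).
Qed.

Let in_normaliser_normal (x g : normaliser G) :
  sg_set G (val x) -> sg_set G (val (x ^ g)).
Proof.
move=> Gx; case: g => g /[dup] Ng /set_mem /= NgG.
by rewrite -NgG; exists (val x).
Qed.

Definition in_normaliser : normal_subgroup (set_type (normaliser G)) :=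
  @NormalSubgroup _ (Subgroup in_normaliser_closed) in_normaliser_normal.
End subgroup_of_normaliser.

Definition normaliser_quotient (T : topologicalGroupType) (G : subgroup T) :=
  @quotient_group (set_type (normaliser G)) (in_normaliser G).

(* Automorphisms of T as a topological group. When T is Polish, in particular
   when T is a closed subgroup of Sym, the continuity of the inverse of a
   continuous automorphism is automatic. *)
Record Aut (T : topologicalGroupType) := MkAut {
  aut_fun :> T -> T ;
  aut_inv : T -> T ;
  autK : cancel aut_fun aut_inv ;
  autVK : cancel aut_inv aut_fun ;
  autM : {morph aut_fun : x y / x * y} ;
  aut_continuous : continuous aut_fun ;
  aut_inv_continuous : continuous aut_inv
}.

HB.instance Definition _ (T : topologicalGroupType) := gen_eqMixin (Aut T).
HB.instance Definition _ (T : topologicalGroupType) := gen_choiceMixin (Aut T).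

Lemma autP (T : topologicalGroupType) (f g : Aut T) : f =1 g -> f = g.
Proof.
move=> /funext; case: f g.
move=> f f' fK f'K fM cf cf' [g g' gK g'K gM cg cg'] /= fg.
subst g; have f'g' : f' = g' by apply/funext => x; rewrite -[in LHS](g'K x) fK.
by subst g'; congr MkAut; exact: Prop_irrelevance.
Qed.

(* Only left cosets are mentioned because a right coset H x is the left coset
   x (x^-1 H x) of another open subgroup. *)
Definition open_coset (T : topologicalGroupType) (A : set T) : Prop :=
  exists (H : subgroup T) (x : T),
    open (sg_set H) /\ A = [set x * h | h in sg_set H].

Section Aut_group.
Context {T : topologicalGroupType}.
Implicit Types f g : Aut T.

Definition aut_one : Aut T :=
  @MkAut T idfun idfun (fun=> erefl) (fun=> erefl) (fun _ _ => erefl)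
    (fun=> cvg_id) (fun=> cvg_id).

Program Definition aut_mul f g : Aut T :=
  @MkAut T (f \o g) (aut_inv g \o aut_inv f) _ _ _ _ _.
Next Obligation. by move=> f g; apply: can_comp; exact: autK. Qed.
Next Obligation. by move=> f g; apply: can_comp; exact: autVK. Qed.
Next Obligation. by move=> f g x y /=; rewrite !autM. Qed.
Next Obligation.
by move=> f g x; apply: continuous_comp; exact: aut_continuous.
Qed.
Next Obligation.
by move=> f g x; apply: continuous_comp; exact: aut_inv_continuous.
Qed.

Program Definition aut_inverse f : Aut T :=
  @MkAut T (aut_inv f) f (autVK f) (autK f) _ (@aut_inv_continuous T f)
    (@aut_continuous T f).
Next Obligation.
by move=> f x y; apply: (can_inj (autK f)); rewrite autM !autVK.
Qed.

Let aut_mulA : associative aut_mul. Proof. by move=> f g h; exact: autP. Qed.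
Let aut_mul1 : left_id aut_one aut_mul. Proof. by move=> f; exact: autP. Qed.
Let aut_mulg1 : right_id aut_one aut_mul. Proof. by move=> f; exact: autP. Qed.
Let aut_mulV : left_inverse aut_one aut_inverse aut_mul.
Proof. by move=> f; apply: autP => x; exact: autK. Qed.
Let aut_mulgV : right_inverse aut_one aut_inverse aut_mul.
Proof. by move=> f; apply: autP => x; exact: autVK. Qed.

HB.instance Definition _ := isGroup.Build (Aut T)
  aut_mulA aut_mul1 aut_mulg1 aut_mulV aut_mulgV.

Definition aut_stab (As : seq (set T)) : set (Aut T) :=
  [set f : Aut T | forall A, A \in As -> f @` A = A].

(* A basis of neighbourhoods of the identity: the automorphisms stabilising
   setwise finitely many given cosets of open subgroups. *)
Definition aut_nbhs1 : set_system (Aut T) :=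
  [set aut_stab As | As in [set As | forall A, A \in As -> open_coset A]].

Lemma aut_open_coset f (A : set T) : open_coset A -> open_coset (f @` A).
Proof.
move=> [H [x [oH ->]]].
have imH : f @` sg_set H = aut_inv f @^-1` sg_set H.
  apply/seteqP; split=> [_ [y Hy <-] /=|y Hy]; first by rewrite autK.
  by exists (aut_inv f y) => //; exact: autVK.
have clH : group_closed [in f @` sg_set H].
  rewrite imH; apply: set_group_closed => /=.
    have := sg1 H; congr (sg_set H _).
    apply: (mulgI (aut_inverse f 1)); rewrite -[RHS]/(_ * aut_inverse f 1).
    by rewrite -autM !mulg1.
  move=> y z Hy Hz; have := sgF Hy Hz; congr (sg_set H _).
  apply: (can_inj (autK f)); apply: (mulIg z).
  by rewrite autVK divgK -[X in _ * X](autVK f z) -autM divgK autVK.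
exists (Subgroup clH), (f x); split => /=.
  by rewrite imH; have /continuousP := @aut_inv_continuous T f; apply.
by rewrite !image_comp; apply: eq_imagel => h _ /=; rewrite autM.
Qed.

Let aut_nbhs1_neq0 : aut_nbhs1 !=set0.
Proof. by exists (aut_stab [::]), [::]. Qed.

Let aut_nbhs1_1 V : aut_nbhs1 V -> V 1.
Proof. by move=> [As _ <-] A _; rewrite image_id. Qed.

Let aut_nbhs1_M V : aut_nbhs1 V -> forall f g, V f -> V g -> V (f * g).
Proof.
move=> [As _ <-] f g fA gA A AAs; rewrite -[LHS]/((f \o g) @` A).
by rewrite -image_comp gA// fA.
Qed.

Let aut_nbhs1_V V : aut_nbhs1 V -> forall f, V f -> V f^-1.
Proof.
move=> [As _ <-] f fA A AAs; rewrite -[X in _ @` X](fA A AAs).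
rewrite -[LHS]/(aut_inv f @` (f @` A)) image_comp.
by rewrite -[RHS]image_id; apply: eq_imagel => x _ /=; rewrite autK.
Qed.

Let aut_nbhs1_I V W : aut_nbhs1 V -> aut_nbhs1 W ->
  exists2 U, aut_nbhs1 U & U `<=` V `&` W.
Proof.
move=> [As cAs <-] [Bs cBs <-]; exists (aut_stab (As ++ Bs)).
  exists (As ++ Bs) => // A; rewrite mem_cat => /orP[]; [exact: cAs|exact: cBs].
by move=> f fAB; split=> A AA; apply: fAB; rewrite mem_cat AA ?orbT.
Qed.

Let aut_nbhs1_J V f : aut_nbhs1 V ->
  exists2 U, aut_nbhs1 U & forall g, U g -> V (g ^ f).
Proof.
move=> [As cAs <-]; exists (aut_stab [seq f @` A | A <- As]).
  exists [seq f @` A | A <- As] => // _ /mapP[A AAs ->].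
  exact/aut_open_coset/cAs.
move=> g gA A AAs; have gfA : g @` (f @` A) = f @` A by apply/gA/map_f.
transitivity (aut_inv f @` (g @` (f @` A))).
  by rewrite image_comp image_comp.
rewrite gfA image_comp -[RHS]image_id.
by apply: eq_imagel => x _ /=; rewrite autK.
Qed.

HB.instance Definition _ := isSubgroupTopological.Build (Aut T)
  aut_nbhs1_neq0 aut_nbhs1_1 aut_nbhs1_M aut_nbhs1_V aut_nbhs1_I aut_nbhs1_J.

Let inner_continuous (g : T) : continuous (fun x : T => g * x * g^-1).
Proof.
move=> x.
apply: (@continuous2_cvg _ _ _ _ _ _ _ _ (fun x y : T => x * y)).
- exact: (@mulg_continuous T (g * x, g^-1)).
- apply: (@continuous2_cvg _ _ _ _ _ _ _ _ (fun x y : T => x * y)).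
  + exact: (@mulg_continuous T (g, x)).
  + exact: cvg_cst.
  + exact: cvg_id.
- exact: cvg_cst.
Qed.

Program Definition inner (g : T) : Aut T :=
  @MkAut T (fun x => g * x * g^-1) (fun x => g^-1 * x * g) _ _ _ _ _.
Next Obligation. by move=> g x; rewrite !mulgA mulVg mul1g divgK. Qed.
Next Obligation. by move=> g x; rewrite !mulgA mulgV mul1g mulgK. Qed.
Next Obligation. by move=> g x y; rewrite !mulgA divgK. Qed.
Next Obligation. by move=> g; exact: inner_continuous. Qed.
Next Obligation.
by move=> g; have := @inner_continuous g^-1; rewrite invgK.
Qed.

Lemma Inn_closed : group_closed [in range inner].
Proof.
apply: set_group_closed.
  by exists 1 => //; apply: autP => x /=; rewrite mul1g invg1 mulg1.
move=> _ _ [g _ <-] [h _ <-]; exists (g / h) => //; apply: autP => x /=.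
by rewrite invgM invgK !mulgA.
Qed.

Lemma Inn_normal (f g : Aut T) : range inner f -> range inner (f ^ g).
Proof.
move=> [x _ <-]; exists (aut_inv g x) => //; apply: autP => y /=.
rewrite -[RHS]/(aut_inverse g (x * g y * x^-1)) !autM /= autK.
congr (_ * _); apply: (mulgI (aut_inv g x)); rewrite mulgV.
rewrite -[RHS]/(aut_inverse g x * aut_inverse g x^-1) -autM mulgV.
by apply: (mulgI (aut_inverse g 1)); rewrite -autM !mulg1.
Qed.

End Aut_group.

Definition Inn (T : topologicalGroupType) : normal_subgroup (Aut T) :=
  @NormalSubgroup _ (Subgroup Inn_closed) Inn_normal.

Definition Out (T : topologicalGroupType) := quotient_group (Inn T).

Record Sym := MkSym {
  sym_fun :> nat -> nat ;
  sym_inv : nat -> nat ;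
  symK : cancel sym_fun sym_inv ;
  symVK : cancel sym_inv sym_fun
}.

HB.instance Definition _ := gen_eqMixin Sym.
HB.instance Definition _ := gen_choiceMixin Sym.

Lemma symP (f g : Sym) : f =1 g -> f = g.
Proof.
move=> /funext; case: f g => f f' fK f'K [g g' gK g'K] /= fg.
subst g; have f'g' : f' = g' by apply/funext => x; rewrite -[in LHS](g'K x) fK.
by subst g'; congr MkSym; exact: Prop_irrelevance.
Qed.

Definition sym_one : Sym := @MkSym idfun idfun (fun=> erefl) (fun=> erefl).

Definition sym_mul (f g : Sym) : Sym :=
  @MkSym (f \o g) (sym_inv g \o sym_inv f)
    (can_comp (symK f) (symK g)) (can_comp (symVK g) (symVK f)).

Definition sym_inverse (f : Sym) : Sym := MkSym (symVK f) (symK f).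

Section Sym_group.

Let sym_mulA : associative sym_mul. Proof. by move=> f g h; exact: symP. Qed.
Let sym_mul1 : left_id sym_one sym_mul. Proof. by move=> f; exact: symP. Qed.
Let sym_mulg1 : right_id sym_one sym_mul. Proof. by move=> f; exact: symP. Qed.
Let sym_mulV : left_inverse sym_one sym_inverse sym_mul.
Proof. by move=> f; apply: symP => x; exact: symK. Qed.
Let sym_mulgV : right_inverse sym_one sym_inverse sym_mul.
Proof. by move=> f; apply: symP => x; exact: symVK. Qed.

HB.instance Definition _ := isGroup.Build Sym
  sym_mulA sym_mul1 sym_mulg1 sym_mulV sym_mulgV.

Definition sym_stab (s : seq nat) : set Sym :=
  [set f : Sym | forall n, n \in s -> f n = n].

Definition sym_nbhs1 : set_system Sym := range sym_stab.

Let sym_nbhs1_neq0 : sym_nbhs1 !=set0.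
Proof. by exists (sym_stab [::]), [::]. Qed.

Let sym_nbhs1_1 V : sym_nbhs1 V -> V 1.
Proof. by move=> [s _ <-]. Qed.

Let sym_nbhs1_M V : sym_nbhs1 V -> forall f g, V f -> V g -> V (f * g).
Proof.
by move=> [s _ <-] f g fs gs n ns; rewrite -[LHS]/(f (g n)) gs// fs.
Qed.

Let sym_nbhs1_V V : sym_nbhs1 V -> forall f, V f -> V f^-1.
Proof.
by move=> [s _ <-] f fs n ns; rewrite -[LHS]/(sym_inv f n) -{1}(fs n ns) symK.
Qed.

Let sym_nbhs1_I V W : sym_nbhs1 V -> sym_nbhs1 W ->
  exists2 U, sym_nbhs1 U & U `<=` V `&` W.
Proof.
move=> [s _ <-] [t _ <-]; exists (sym_stab (s ++ t)); first by exists (s ++ t).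
by move=> f fst; split=> n nst; apply: fst; rewrite mem_cat nst ?orbT.
Qed.

Let sym_nbhs1_J V f : sym_nbhs1 V ->
  exists2 U, sym_nbhs1 U & forall g, U g -> V (g ^ f).
Proof.
move=> [s _ <-]; exists (sym_stab (map f s)); first by exists (map f s).
move=> g gs n ns; rewrite -[LHS]/(sym_inv f (g (f n))) gs ?symK//.
exact: map_f.
Qed.

HB.instance Definition _ := isSubgroupTopological.Build Sym
  sym_nbhs1_neq0 sym_nbhs1_1 sym_nbhs1_M sym_nbhs1_V sym_nbhs1_I sym_nbhs1_J.

End Sym_group.

Definition tuple_orbit (G : subgroup Sym) (n : nat) (t : n.-tuple nat) :
  set (n.-tuple nat) := [set map_tuple g t | g in sg_set G].

Definition oligomorphic (G : subgroup Sym) : Prop :=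
  forall n : nat, finite_set (range (@tuple_orbit G n)).

Definition polish (R : realType) (T : topologicalType) : Prop :=
  (exists2 D : set T, countable D & dense D) /\
  exists (M : metricType R) (f : T -> M) (g : M -> T),
    [/\ cancel f g, cancel g f, continuous f, continuous g &
        forall F : set_system M, ProperFilter F -> cauchy F ->
          exists x : M, F --> x].

Definition profinite (T : topologicalGroupType) : Prop :=
  [/\ compact [set: T], hausdorff_space T & totally_disconnected [set: T]].

(* Main.v *)
Require Import Defs.
From HB Require Import structures.
From mathcomp Require Import all_boot all_order all_algebra.
From mathcomp Require Import all_classical all_reals all_analysis.

(* Write G_s for the pointwise stabiliser in G of a finite tuple s.

   An oligomorphic group is Roelcke precompact, so a coset of an open subgroup
   of G is determined by finitely many finite tuples. Hence there are countably
   many such cosets, which makes Aut(G) separable and gives it a countable base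
   at 1, and conjugation N_G -> Aut(G) is continuous.

   (a) Let inner(g) converge to an automorphism along an ultrafilter. For each
   point a, the elements g of some set in the ultrafilter conjugate G_a to the
   same subgroup, so the points g a differ by fixed points of G_a, of which
   there are finitely many. Thus g a, and likewise g^-1 a, is eventually
   constant, and g converges in G.

   (b) An ultrafilter on N_G/G converges: a back-and-forth construction, based
   on the finiteness of the set of orbits of G on n-tuples, produces a
   permutation f such that every finite restriction of f is induced by some
   element of almost every coset.

   (c) If Phi fixes G_a for a in a finite set of orbit representatives, then
   h(g a) = Phi(g) a is a well-defined element of N_G that induces Phi. So the
   image of N_G in Aut(G) is open, and the image of the compact group N_G/G is
   a compact neighbourhood of 1 in Out(G).

   A group with a countable base at 1 of open subgroups V_n with trivial
   intersection has the left-invariant ultrametric d(x, y) = 1/(n+1), n least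
   with x^-1 y outside V_n. It is complete if the group is locally compact. *)

Set Implicit Arguments.
Unset Strict Implicit.
Unset Printing Implicit Defensive.

Import Order.TTheory GRing.Theory Num.Theory.
Local Open Scope classical_set_scope.
Local Open Scope group_scope.

(** * Filters and ultrafilters *)

(** If the complement of [B j] lies in [F], the remaining indices still cover a set of [F]. *)
Lemma ultra_finite (I : Type) (J : eqType) (F : set_system I) (s : seq J)
    (B : J -> set I) :
  UltraFilter F -> F [set i | exists2 j, j \in s & B j i] ->
  exists2 j, j \in s & F (B j).
Proof.
move=> UF; elim: s => [|j s IH] Fs.
  by have [i [j]] := filter_ex Fs.
have [FB|FB] := in_ultra_setVsetC (B j) UF.
  by exists j => //; exact: mem_head.
have [|k ks FBk] := IH; last by exists k => //; rewrite in_cons ks orbT.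
apply: filterS (filterI Fs FB) => i [[k]].
by rewrite in_cons => /predU1P[->//|ks Bki _]; exists k.
Qed.

Lemma filter_seq (I : Type) (J : eqType) (F : set_system I) (s : seq J)
    (B : J -> set I) :
  Filter F -> (forall j, j \in s -> F (B j)) ->
  F [set i | forall j, j \in s -> B j i].
Proof.
move=> FF; elim: s => [|j s IH] Fs; first exact: filterS filterT.
have Fj := Fs _ (mem_head j s).
have {}IH : F [set i | forall j, j \in s -> B j i].
  by apply: IH => k ks; apply: Fs; rewrite in_cons ks orbT.
apply: filterS (filterI Fj IH) => i [Bj Bs] k.
by rewrite in_cons => /predU1P[->//|/Bs].
Qed.

(** * Topological groups with a countable base of open subgroups at 1 *)

Section topological_group.
Context {T : topologicalGroupType}.
Implicit Types (g x y : T) (A : set T).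

Lemma mulgl_continuous g : continuous (fun x => g * x).
Proof.
move=> x; apply: (@continuous2_cvg _ _ _ _ _ _ _ _ (fun x y : T => x * y)).
- exact: (@mulg_continuous T (g, x)).
- exact: cvg_cst.
- exact: cvg_id.
Qed.

Lemma nbhs_mulg1 g A : nbhs g A <-> nbhs 1 [set x | A (g * x)].
Proof.
split=> [gA|hA].
  by apply: (@mulgl_continuous g 1 A) => /=; rewrite mulg1.
have : nbhs g ((fun x => g^-1 * x) @^-1` [set x | A (g * x)]).
  by apply: (@mulgl_continuous g^-1 g); rewrite mulVg.
by apply: filterS => x /=; rewrite mulVKg.
Qed.

Definition subgroup_base (V : nat -> subgroup T) : Prop :=
  (forall n, nbhs 1 (sg_set (V n))) /\
  (forall A, nbhs 1 A -> exists n, sg_set (V n) `<=` A).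

Section base.
Variable V : nat -> subgroup T.
Hypothesis baseV : subgroup_base V.

Lemma subgroup_base_nbhsP g A :
  nbhs g A <-> exists n, forall x, sg_set (V n) x -> A (g * x).
Proof.
case: baseV => V1 VA; split=> [/nbhs_mulg1/VA[n VnA]|[n VnA]].
  by exists n => x /VnA.
by apply/nbhs_mulg1; apply: filterS (V1 n).
Qed.

Lemma subgroup_base_clopen n g : clopen [set x | sg_set (V n) (g^-1 * x)].
Proof.
have op (P : set T) : (forall x y, P x -> sg_set (V n) y -> P (x * y)) ->
    open P.
  move=> PV; rewrite openE => x Px; apply/subgroup_base_nbhsP.
  by exists n => y; exact: PV.
split; first by apply: op => x y /= Vx Vy; rewrite mulgA; exact: sgM.
rewrite -openC; apply: op => x y /= Vx Vy; apply: contra_not Vx => Vxy.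
by have := sgF Vxy Vy; rewrite mulgA mulgK.
Qed.

(** Equal codes at level [n] force equal left cosets of [V n], so one point for each level and code
    value suffices. *)
Lemma subgroup_base_separable (C : countType) (code : nat -> T -> C) :
  (forall n x y, code n x = code n y -> sg_set (V n) (x^-1 * y)) ->
  exists2 D : set T, countable D & dense D.
Proof.
move=> codeV; exists (range (fun nc => xget 1 (code nc.1 @^-1` [set nc.2]))).
  exact: sub_countable (card_image_le _ _) (countableP _).
move=> O [x Ox] oO.
have /subgroup_base_nbhsP[n VnO] : nbhs x O by exact: open_nbhs_nbhs.
exists (xget 1 (code n @^-1` [set code n x])).
split; last by exists (n, code n x).
case: xgetP => [y _ /= yx|/(_ x)]; last by case.
by rewrite -[y](mulVKg x); apply/VnO/codeV.
Qed.

Hypothesis sepV : forall x, (forall n, sg_set (V n) x) -> x = 1.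

Lemma subgroup_base_zero_dimensional : zero_dimensional T.
Proof.
move=> x y /eqP xy; have /existsNP[n nVn] : ~ forall n, sg_set (V n) (x^-1 * y).
  by move=> /sepV /(congr1 (fun z => x * z)); rewrite mulVKg mulg1 => /esym.
exists [set z | sg_set (V n) (x^-1 * z)]; split => //.
  exact: subgroup_base_clopen.
by rewrite /= mulVg; exact: sg1.
Qed.

Lemma subgroup_base_totally_disconnected : totally_disconnected [set: T].
Proof.
exact/zero_dimension_totally_disconnected/subgroup_base_zero_dimensional.
Qed.

Lemma subgroup_base_hausdorff : hausdorff_space T.
Proof.
rewrite open_hausdorff => x y.
move=> /subgroup_base_zero_dimensional[U [[oU cU] Ux nUy]].
exists (U, ~` U); first by split; rewrite inE.
by split => //=; [rewrite openC|rewrite setICr].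
Qed.

Lemma subgroup_base_compact_coset (K : set T) n x :
  compact K -> sg_set (V n) `<=` K -> compact [set y | sg_set (V n) (x^-1 * y)].
Proof.
move=> cK VnK.
rewrite (_ : [set y | _] = (fun z => x * z) @` sg_set (V n)); last first.
  apply/seteqP; split=> [y /= Vy|_ [y Vy <-]] /=; last by rewrite mulKg.
  by exists (x^-1 * y) => //; rewrite mulVKg.
apply: continuous_compact.
  by apply: continuous_subspaceT => y; exact: mulgl_continuous.
apply: subclosed_compact cK VnK.
have [_] := subgroup_base_clopen n 1.
by congr closed; apply/seteqP; split => y /=; rewrite invg1 mul1g.
Qed.

Lemma subgroup_base_locally_compact (K : set T) :
  nbhs 1 K -> compact K -> locally_compact [set: T].
Proof.
move=> /(proj2 baseV)[n VnK] cK x _.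
have [oV cV] := subgroup_base_clopen n x.
exists [set y | sg_set (V n) (x^-1 * y)].
  rewrite withinET; apply: open_nbhs_nbhs; split => //.
  by rewrite /= mulVg; exact: sg1.
by split => //; exact: subgroup_base_compact_coset VnK.
Qed.

End base.
End topological_group.

(** * The left-invariant ultrametric *)

Section ultrametric.
Context {T : topologicalGroupType} (R : realType) (V : nat -> subgroup T).
Hypothesis sepV : forall x, (forall n, sg_set (V n) x) -> x = 1.

(** A copy of [T] that carries the metric beside the given topology. Its argument is a proof because
    separation is what makes [udist] definite. *)
Definition ultrametric of (forall x, (forall n, sg_set (V n) x) -> x = 1) :
  Type := T.

Definition udist (x y : T) : R :=
  if pselect (exists n, (x^-1 * y) \notin (V n : set T)) is left h
  then ((ex_minn h).+1%:R^-1)%R else 0%R.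

Lemma udistP x y :
  (udist x y = 0%R /\ forall n, sg_set (V n) (x^-1 * y)) \/
  exists n, [/\ udist x y = (n.+1%:R^-1)%R, ~ sg_set (V n) (x^-1 * y) &
    forall i, (i < n)%N -> sg_set (V i) (x^-1 * y)].
Proof.
rewrite /udist; case: pselect => [h|h]; [right|left].
  case: ex_minnP => n nVn min_n; exists n; split => //.
    by rewrite notin_setE in nVn.
  move=> i; apply: contraPP => nVi; apply/negP; rewrite -leqNgt.
  by apply: min_n; rewrite notin_setE.
split=> // n; apply: contrapT => nVn; apply: h; exists n.
by rewrite notin_setE.
Qed.

Lemma udist_ge x y n :
  ~ sg_set (V n) (x^-1 * y) -> (n.+1%:R^-1 <= udist x y)%R.
Proof.
have [[_ /(_ n)]//|[m [-> _ minm]] nVn] := udistP x y.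
rewrite lef_pV2 ?posrE ?ltr0n// ler_nat ltnS leqNgt.
by apply/negP => /minm.
Qed.

Lemma udist_ge0 x y : (0 <= udist x y)%R.
Proof. by have [[->]//|[n [->]]] := udistP x y; rewrite invr_ge0. Qed.

Lemma udist_le x y (e : R) : (0 <= e)%R ->
  (forall n, ~ sg_set (V n) (x^-1 * y) -> (n.+1%:R^-1 <= e)%R) ->
  (udist x y <= e)%R.
Proof.
by move=> e0; have [[->]//|[n [-> nVn _]]] := udistP x y => /(_ n nVn).
Qed.

Let udistxx x : udist x x = 0%R.
Proof.
have [[]//|[n [_ + _]]] := udistP x x.
by rewrite mulVg => /(_ (sg1 _)).
Qed.

Let udist_eq0 x y : udist x y = 0%R -> x = y.
Proof.
have [[_ /sepV xy _]|[n [-> _ _]] /eqP] := udistP x y; last first.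
  by rewrite invr_eq0 pnatr_eq0.
by rewrite -[y](mulVKg x) xy mulg1.
Qed.

Let udist_sym x y : udist x y = udist y x.
Proof.
suff h a b : (udist a b <= udist b a)%R by apply/le_anti; rewrite !h.
apply: udist_le (udist_ge0 _ _) _ => n nVn; apply: udist_ge.
by apply: contra_not nVn => /sgV; rewrite invgM invgK.
Qed.

Let udist_triangle y x z : (udist x z <= udist x y + udist y z)%R.
Proof.
apply: udist_le; first by rewrite addr_ge0// udist_ge0.
move=> n nVn.
have [Vxy|/udist_ge xy] := pselect (sg_set (V n) (x^-1 * y)); last first.
  by rewrite (le_trans xy)// lerDl udist_ge0.
have /udist_ge yz : ~ sg_set (V n) (y^-1 * z).
  apply: contra_not nVn => Vyz; have := sgM Vxy Vyz.
  by rewrite mulgA mulgK.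
by rewrite (le_trans yz)// lerDr udist_ge0.
Qed.

HB.instance Definition _ := Choice.copy (ultrametric sepV) T.
HB.instance Definition _ := isMetric.Build R (ultrametric sepV)
  udistxx udist_eq0 udist_sym udist_triangle.

Hypothesis baseV : subgroup_base V.

Lemma subgroup_base_polish (K : set T) :
  (exists2 D : set T, countable D & dense D) ->
  nbhs 1 K -> compact K -> polish R T.
Proof.
move=> sepT K1 cK; split => //.
have near_ball (x : T) (e : R) : (0 < e)%R ->
    nbhs x [set y | (udist x y < e)%R].
  move=> e0; have [N Ne] : exists N, (N.+1%:R^-1 < e)%R.
    have [N _ /(_ N (leqnn N))] := near_infty_natSinv_lt (PosNum e0).
    by exists N.
  apply/nbhs_mulg1.
  (* The [V n] need not be nested; on the intersection of [V 0], ..., [V N] the first exit index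
     exceeds [N]. *)
  have : nbhs (1 : T) [set y | forall i, i \in iota 0 N.+1 -> sg_set (V i) y].
    by apply: filter_seq => i _; exact: (proj1 baseV i).
  apply: filterS => y Vy /=.
  apply: le_lt_trans Ne; apply: udist_le => [|m]; first by rewrite invr_ge0.
  rewrite mulKg => nVm; rewrite lef_pV2 ?posrE ?ltr0n// ler_nat ltnS leqNgt.
  apply/negP => mN; apply: nVm; apply: Vy; rewrite mem_iota add0n leq0n.
  exact: ltnW.
have sub_ball n (x : T) : [set y | (udist x y < n.+1%:R^-1)%R] `<=`
    [set y | sg_set (V n) (x^-1 * y)].
  move=> y /= xy; apply: contrapT => /udist_ge.
  by rewrite leNgt xy.
exists (ultrametric sepV), idfun, idfun; split => //.
- move=> x A /nbhs_ballP[e /= e0 eA].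
  by apply: filterS eA _; exact: near_ball.
- move=> x A /(subgroup_base_nbhsP baseV)[n VnA].
  apply/nbhs_ballP; exists (n.+1%:R^-1)%R; first by rewrite /= invr_gt0.
  by move=> y /sub_ball /VnA; rewrite mulVKg.
move=> F PF /cauchyP cF.
have [n VnK] := proj2 baseV K K1.
have n1 : (0 < n.+1%:R^-1 :> R)%R by rewrite invr_gt0.
(* A small ball lies in a compact coset of [V n], so the Cauchy filter has a cluster point [y]. *)
have [x /(filterS (@sub_ball n x)) Fx] := cF _ n1.
have [y [_ Fy]] := subgroup_base_compact_coset baseV cK VnK PF Fx.
exists y => A /nbhs_ballP[e /= e0 eA].
(* Some [w] in the e/4-ball around [z] is within e/2 of [y], so that whole ball lies within e of
   [y]. *)
have e2 : (0 < e / 2)%R by rewrite divr_gt0.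
have e4 : (0 < e / 2 / 2)%R by rewrite divr_gt0.
have [z Fz] := cF _ e4.
have [w [zw yw]] := Fy _ _ Fz (near_ball y _ e2).
apply: filterS Fz => t zt; apply: eA.
apply: (@ball_splitr _ (ultrametric sepV) w); first exact: ball_sym.
apply: (@ball_splitr _ (ultrametric sepV) z) => //; exact: ball_sym.
Qed.

End ultrametric.

(** * Bases and separability of quotient groups *)

Section quotient_base.
Context {T : topologicalGroupType} (N : normal_subgroup T).
Let Q := quotient_group N.

Let image_closed (V : subgroup T) :
  group_closed [in @to_coset T N @` sg_set V].
Proof.
apply: set_group_closed => [|_ _ [x Vx <-] [y Vy <-]].
  by exists 1 => //; exact: sg1.
by exists (x / y); [exact: sgF|rewrite coset_mulg coset_invg].
Qed.

Definition coset_subgroup (V : subgroup T) : subgroup Q :=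
  Subgroup (@image_closed V).

Lemma coset_subgroup_base (V : nat -> subgroup T) :
  subgroup_base V -> subgroup_base (fun n => coset_subgroup (V n)).
Proof.
move=> [V1 VA]; split=> [n|A A1]; first exact: (coset_nbhs N (V1 n)).
have /VA[n VnA] := coset_continuous A1.
by exists n => _ [x /VnA Ax <-].
Qed.

(** If x N meets every [V n], then x lies in the closure of N, which is N. *)
Lemma coset_subgroup_separated (V : nat -> subgroup T) :
  subgroup_base V -> closed (sg_set N) ->
  forall a : Q, (forall n, sg_set (coset_subgroup (V n)) a) -> a = 1.
Proof.
move=> baseV cN a; rewrite -(coset_repr a); set x := repr a => Va.
rewrite -[RHS]/(to_coset N 1); apply/cosetP; rewrite mulg1.
apply: sgV; apply: contrapT => nNx.
have /(subgroup_base_nbhsP baseV)[n VnN] : nbhs x (~` sg_set N).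
  by apply: open_nbhs_nbhs; split => //; rewrite openC.
have [v Vv /cosetP Nvx] := Va n.
(* Normality turns v^-1 x in N into x v^-1 in N, a point of x [V n]. *)
have := nsg_normal v^-1 Nvx; rewrite conjgE invgK mulgA mulVKg.
by apply: VnN; exact: sgV.
Qed.

Lemma coset_dense (D : set T) : dense D -> dense (@to_coset T N @` D).
Proof.
move=> dD O [a Oa] oO.
have [|x [Ox Dx]] := dD (@to_coset T N @^-1` O) _ oO.
  by exists (repr a); rewrite /= coset_repr.
by exists (to_coset N x); split => //; exists x.
Qed.

Lemma coset_separable :
  (exists2 D : set T, countable D & dense D) ->
  exists2 D : set Q, countable D & dense D.
Proof.
move=> [D cD dD]; exists (@to_coset T N @` D); last exact: coset_dense.
exact: sub_countable (card_image_le _ _) cD.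
Qed.

End quotient_base.

(** * Subgroups of Sym and their pointwise stabilisers *)

Section permutation_group.
Variable H : subgroup Sym.
Local Notation S := (set_type (sg_set H)).
Implicit Types (x y z : S) (s t : seq nat).

Definition act x (n : nat) : nat := (val x : Sym) n.

Lemma actM x y n : act (x * y) n = act x (act y n).
Proof. by []. Qed.

Lemma act1 n : act 1 n = n.
Proof. by []. Qed.

Lemma actK x n : act x^-1 (act x n) = n.
Proof. by rewrite -actM mulVg. Qed.

Lemma actVK x n : act x (act x^-1 n) = n.
Proof. by rewrite -actM mulgV. Qed.

Lemma act_inj x : injective (act x).
Proof. exact: can_inj (actK x). Qed.

Lemma actP x y : act x =1 act y -> x = y.
Proof. by move=> xy; apply/val_inj/symP. Qed.

Lemma mem_val x : sg_set H (val x).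
Proof. by case: x => x /= /set_mem. Qed.

Lemma sub_act (g : Sym) : sg_set H g -> exists x, act x =1 g.
Proof. by move=> Hg; exists (SigSub (mem_set Hg)). Qed.

Lemma sym_nbhsP (g : Sym) (A : set Sym) :
  nbhs g A <-> exists s, forall f : Sym, {in s, f =1 g} -> A f.
Proof.
split=> [[_ [s _ <-] sA]|[s sA]].
  exists s => f fg; rewrite -[f](mulVKg g); apply: sA => n ns.
  by rewrite -[LHS]/(sym_inv g (f n)) fg// symK.
exists (sym_stab s); first by exists s.
by move=> f fs; apply: sA => n ns; rewrite -[LHS]/(g (f n)) fs.
Qed.

Lemma act_nbhsP x (A : set S) :
  nbhs x A <-> exists s, forall y, {in s, act y =1 act x} -> A y.
Proof.
split.
  rewrite nbhsE => -[_ [[B oB <-] /= Bx] BA].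
  have /sym_nbhsP[s sB] : nbhs (val x) B by exact: open_nbhs_nbhs.
  by exists s => y xy; apply: BA; apply: sB.
move=> [s sA]; have : nbhs (val x) [set f : Sym | {in s, f =1 val x}].
  by apply/sym_nbhsP; exists s.
move=> /(@initial_continuous _ _ (val : S -> Sym) x) xs.
have {}xs : nbhs x [set y | {in s, act y =1 act x}] by exact: xs.
by apply: filterS xs => y; exact: sA.
Qed.

Lemma sym_closedP : closed (sg_set H) ->
  forall f : Sym, (forall s, exists x, {in s, act x =1 f}) -> sg_set H f.
Proof.
move=> cH f fH; apply: cH => A /sym_nbhsP[s sA].
have [x xf] := fH s; exists (val x); split; [exact: mem_val|exact: sA].
Qed.

Let pstab_closed s : group_closed [in [set x | {in s, act x =1 id}]].
Proof.
apply: set_group_closed => [n _|x y xs ys n ns]; first exact: act1.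
by rewrite actM -{1}(ys n ns) actK xs.
Qed.

Definition pstab s : subgroup S := Subgroup (@pstab_closed s).

Lemma pstabP s x : sg_set (pstab s) x <-> {in s, act x =1 id}.
Proof. by []. Qed.

Lemma open_pstab s : open (sg_set (pstab s)).
Proof.
rewrite openE => x xs; apply/act_nbhsP; exists s => y yx n ns.
by rewrite yx// xs.
Qed.

Lemma pstab_base : subgroup_base (fun n => pstab (iota 0 n)).
Proof.
split=> [n|A /act_nbhsP[s sA]].
  by apply: open_nbhs_nbhs; split; [exact: open_pstab|exact: sg1].
exists (\max_(n <- s) n).+1 => x xs; apply: sA => n ns; apply: xs.
rewrite mem_iota add0n ltnS; exact: leq_bigmax_seq.
Qed.

Lemma act_separable : exists2 D : set S, countable D & dense D.
Proof.
apply: (subgroup_base_separable pstab_base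
  (code := fun n x => [seq act x i | i <- iota 0 n])).
move=> n x y /eq_in_map xy i /xy yi.
by rewrite actM -yi actK.
Qed.

End permutation_group.

(** * Finiteness of orbits and the coding of open cosets *)

Section oligomorphic.
Variable G : subgroup Sym.
Hypothesis oligG : oligomorphic G.
Local Notation S := (set_type (sg_set G)).
Implicit Types (x y z g : S) (s t : seq nat).

Lemma finite_transversal (n : nat) (P : set (seq nat)) :
  (forall t, P t -> size t = n) ->
  exists2 L : seq (seq nat), (forall t, t \in L -> P t) &
    forall s, P s -> exists2 t, t \in L & exists g : S, map (act g) s = t.
Proof.
move=> Pn; have /finite_seqP[Os OsE] := oligG n.
pose rep (X : set (n.-tuple nat)) :=
  xget (nseq_tuple n 0) [set t : n.-tuple nat | tuple_orbit G t = X /\ P t].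
(* [xget] gives the zero tuple for an orbit that misses [P]; the filter discards it unless it lies
   in [P]. *)
exists [seq t <- [seq val (rep X) | X <- Os] | `[< P t >]].
  by move=> t; rewrite mem_filter => /andP[/asboolP].
move=> s Ps; pose st := Tuple (introT eqP (Pn s Ps)).
have OsO : tuple_orbit G st \in Os.
  have : range (@tuple_orbit G n) (tuple_orbit G st) by exists st.
  by rewrite OsE.
have [] : tuple_orbit G (rep (tuple_orbit G st)) = tuple_orbit G st /\
    P (rep (tuple_orbit G st)).
  by rewrite /rep; case: xgetP => [//|/(_ st)]; case.
move: (rep _) (map_f (fun X => val (rep X)) OsO) => r rOs Er Pr.
exists (val r); first by rewrite mem_filter rOs andbT; exact/asboolP.
have : tuple_orbit G st r.
  by rewrite -Er; exists 1; [exact: sg1|apply/val_inj; rewrite /= map_id].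
move=> [f /(@sub_act G)[g gf] <-]; exists g.
exact: eq_map.
Qed.

(* Roelcke precompactness: an open subgroup contains some G_s, and is then a
   finite union of double cosets of G_s. So the coset x H is determined by s,
   x s, and the tuples y s, where y represents one of these double cosets. *)
Definition coset_code : Type := seq nat * seq nat * seq (seq nat).

(** For c = (s, x s, [y_1 s, ..., y_k s]) this is the union of the sets x G_s y_i G_s. *)
Definition coded_coset (c : coset_code) : set S :=
  [set z | exists2 g : S, map (act g) c.1.1 = c.1.2 &
    exists2 t, t \in c.2 & map (act z) c.1.1 = map (act g) t].

Lemma map_act_eq x y s t :
  map (act x) s = map (act y) t <-> map (act (y^-1 * x)) s = t.
Proof.
split=> [xy|<-]; last first.
  by rewrite -map_comp; apply: eq_map => n /=; rewrite -actM mulVKg.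
rewrite -[RHS](mapK (actK y)) -xy -[RHS]map_comp.
exact: eq_map.
Qed.

Lemma map_act_id x s : map (act x) s = s <-> sg_set (pstab G s) x.
Proof.
rewrite -[X in _ = X]map_id; split=> [/eq_in_map//|xs].
exact/eq_in_map.
Qed.

Lemma open_coset_codeP (A : set S) :
  open_coset A -> exists c, A = coded_coset c.
Proof.
move=> [H [x [oH ->]]].
have /act_nbhsP[s sH] : nbhs 1 (sg_set H).
  by apply: open_nbhs_nbhs; split => //; exact: sg1.
have {}sH y : map (act y) s = s -> sg_set H y.
  by move=> ys; apply: sH; apply/map_act_id.
(* The G-orbits of the pairs (s, y s) correspond to the double cosets G_s y G_s. *)
pose P := [set s ++ map (act y) s | y in sg_set H].
have [_ [y _ <-]|L LP PL] := @finite_transversal (size s + size s) P.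
  by rewrite size_cat size_map.
exists (s, map (act x) s, map (drop (size s)) L).
apply/seteqP; split=> [_ [y Hy <-]|z [g /= gs [_ /mapP[t /LP[y Hy <-]] ->]]].
  have [_ /[dup]/LP[y' Hy' <-] Ly' [g]] := PL _ (@imageP _ _ _ _ y Hy).
  rewrite map_cat => /eqP; rewrite eqseq_cat ?size_map//.
  move=> /andP[/eqP gs /eqP gy].
  (* Here g lies in G_s and g y s = y' s, so x y s = (x g^-1) y' s. *)
  exists (x * g^-1) => /=.
    apply/map_act_eq; rewrite mulKg.
    exact/map_act_id/sgV/map_act_id.
  exists (map (act y') s); last first.
    rewrite -gy -!map_comp; apply: eq_map => n /=.
    by rewrite !actM actK.
  by apply/mapP; exists (s ++ map (act y') s); rewrite // drop_size_cat.
(* x^-1 z is the product of x^-1 g, y and (g y)^-1 z, all in [H]. *)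
rewrite drop_size_cat// -map_comp => zs; exists (x^-1 * z); last exact: mulVKg.
have /sH Hg : map (act (x^-1 * g)) s = s by apply/map_act_eq.
have /sH Hz : map (act ((g * y)^-1 * z)) s = s by apply/map_act_eq.
have := sgM (sgM Hg Hy) Hz.
by rewrite invgM !mulgA mulgK mulgK.
Qed.

(** Let G_a fix b and b'. An element taking (a, b) to (a, b') lies in G_a, so b = b'; thus distinct
    such b give distinct orbits of pairs. *)
Lemma finite_fixed_points a :
  exists s, forall b, (forall g : S, act g a = a -> act g b = b) -> b \in s.
Proof.
pose P := [set [:: a; b] |
  b in [set b | forall g : S, act g a = a -> act g b = b]].
have [_ [b _ <-]//|L LP PL] := @finite_transversal 2 P.
exists (map (nth 0 ^~ 1%N) L) => b ab; apply/mapP.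
have [_ /[dup]/LP[b' ab' <-] Lb' [g [ga gb]]] := PL _ (@imageP _ _ _ _ b ab).
by exists [:: a; b'] => //=; rewrite -gb ab.
Qed.

Definition orep (n : nat) : nat := xget 0 [set m | exists g : S, act g n = m].

Lemma orep_act g n : orep (act g n) = orep n.
Proof.
congr xget; apply/seteqP; split=> m [h hm].
  by exists (h * g); rewrite actM.
by exists (h * g^-1); rewrite actM actK.
Qed.

Lemma orepP n : exists g, act g (orep n) = n.
Proof.
rewrite /orep; case: xgetP => [m _ [g <-]|/(_ n)].
  by exists g^-1; rewrite actK.
by case; exists 1.
Qed.

Lemma orep_idem n : orep (orep n) = orep n.
Proof. by have [h hn] := orepP n; rewrite -{2}hn orep_act. Qed.

Lemma finite_orep : exists s, forall n, orep n \in s.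
Proof.
have [_ [n _ <-]//|L LP PL] :=
  @finite_transversal 1 (range (fun n => [:: orep n])).
exists (map (head 0) L) => n; apply/mapP.
have [_ /[dup]/LP[m _ <-] Lm [g [gn]]] := PL _ (@imageP _ _ _ _ n I).
exists [:: orep m] => //=.
by rewrite -[LHS]orep_idem -[LHS](orep_act g) gn orep_idem.
Qed.

End oligomorphic.

(** * The topology of Aut(G) and the closedness of Inn(G) *)

Section automorphisms.
Variable G : subgroup Sym.
Hypothesis oligG : oligomorphic G.
Local Notation S := (set_type (sg_set G)).
Implicit Types (x y z g : S) (s t : seq nat) (f : Aut S).

Lemma autME f f' x : (f * f') x = f (f' x).
Proof. by []. Qed.

Lemma autKg f x : f^-1 (f x) = x.
Proof. exact: autK. Qed.

Lemma aut1 f : f 1 = 1.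
Proof. by apply: (mulgI (f 1)); rewrite -autM !mulg1. Qed.

Lemma autV f x : f x^-1 = (f x)^-1.
Proof. by apply: (mulgI (f x)); rewrite -autM !mulgV aut1. Qed.

Lemma aut_invK f (A : set S) : aut_inv f @` (f @` A) = A.
Proof.
rewrite image_comp -[RHS]image_id.
by apply: eq_imagel => x _; exact: autK.
Qed.

Lemma aut_nbhsP f (A : set (Aut S)) :
  nbhs f A <-> exists2 As, (forall B, B \in As -> open_coset B) &
    forall f', aut_stab As f' -> A (f * f').
Proof.
split=> [[_ [As oAs <-] AA]|[As oAs AA]]; first by exists As.
by exists (aut_stab As) => //; exists As.
Qed.

Let aut_stab_closed (As : seq (set S)) : group_closed [in aut_stab As].
Proof.
apply: set_group_closed => [B _|f f' fAs f'As B BAs]; first exact: image_id.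
rewrite -[LHS]/((f \o aut_inv f') @` B) -image_comp.
by rewrite -{1}(f'As B BAs) aut_invK fAs.
Qed.

Definition aut_stab_subgroup (As : seq (set S)) : subgroup (Aut S) :=
  Subgroup (@aut_stab_closed As).

(** Every finite list of open cosets occurs: [n] encodes a list of codes, and the filter drops those
    of other sets. A number encoding nothing gives the empty list. *)
Definition open_cosets (n : nat) : seq (set S) :=
  [seq A <- [seq coded_coset (G := G) c | c <- odflt [::] (unpickle n)]
  | `[< open_coset A >]].

Lemma aut_base : subgroup_base (fun n => aut_stab_subgroup (open_cosets n)).
Proof.
split=> [n|A /aut_nbhsP[As oAs AA]].
  apply/aut_nbhsP; exists (open_cosets n) => // B.
  by rewrite mem_filter => /andP[/asboolP].
have [cs csE] : exists cs, As = [seq coded_coset c | c <- cs].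
  elim: As oAs {AA} => [|B As IH] oAs; first by exists [::].
  have [|cs ->] := IH.
    by move=> C CAs; apply: oAs; rewrite in_cons CAs orbT.
  have [c ->] := open_coset_codeP oligG (oAs B (mem_head _ _)).
  by exists (c :: cs).
exists (pickle cs) => f; rewrite /= /open_cosets pickleK /= -csE => fAs.
rewrite -[f]mul1g; apply: AA => B BAs; apply: fAs.
by rewrite mem_filter BAs andbT; apply/asboolP/oAs.
Qed.

(** Modulo the stabiliser of [open_cosets n], [f] is determined by the images of these cosets, which
    again have codes. *)
Lemma aut_separable : exists2 D : set (Aut S), countable D & dense D.
Proof.
pose code (A : set S) : coset_code :=
  xget ([::], [::], [::]) [set c | A = coded_coset c].
apply: (subgroup_base_separable aut_base
  (code := fun n f => [seq code (f @` A) | A <- open_cosets n])).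
move=> n f f' ff' A An.
have oA : open_coset A by move: An; rewrite mem_filter => /andP[/asboolP].
have codeK f0 : f0 @` A = coded_coset (code (f0 @` A)).
  rewrite /code; case: xgetP => [//|no].
  have [c Ac] := open_coset_codeP oligG (aut_open_coset f0 oA).
  by case: (no c).
rewrite -[LHS]/((aut_inv f \o f') @` A) -image_comp codeK.
by have /eq_in_map/(_ A An) <- := ff'; rewrite -codeK aut_invK.
Qed.

Lemma open_coset_pstab x s :
  open_coset [set y : S | map (act y) s = map (act x) s].
Proof.
exists (pstab G s), x; split; first exact: open_pstab.
apply/seteqP; split=> [y /map_act_eq/map_act_id xy|_ [y /map_act_id ys <-]].
  by exists (x^-1 * y) => //; exact: mulVKg.
by apply/map_act_eq; rewrite mulKg.
Qed.

(** For all x and n, [f] preserves the open coset of the y with y n = x n, so f(x) n = x n. *)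
Lemma aut_separated f :
  (forall n, sg_set (aut_stab_subgroup (open_cosets n)) f) -> f = 1.
Proof.
move=> fn; apply: autP => x; apply: actP => n.
have /(proj2 aut_base)[k] : nbhs (1 : Aut S)
    (aut_stab [:: [set y : S | map (act y) [:: n] = map (act x) [:: n]]]).
  apply/aut_nbhsP; eexists; last by move=> f'; rewrite mul1g; apply.
  by move=> B; rewrite inE => /eqP ->; exact: open_coset_pstab.
move=> /(_ f (fn k) _ (mem_head _ _)) fE.
have : (f @` [set y : S | map (act y) [:: n] = map (act x) [:: n]]) (f x).
  by exists x.
by rewrite fE => -[].
Qed.

Definition code_points (c : coset_code) : seq nat :=
  c.1.1 ++ c.1.2 ++ flatten c.2.

(** * Conjugation by elements of [H], used for both [inner] and [normaliser_aut] *)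

Section conjugation.
Variables (H : subgroup Sym) (conj : set_type (sg_set H) -> Aut S).
Hypothesis conjE : forall h x, val (conj h x) = val h * val x * (val h)^-1.

Lemma act_conj h x n : act (conj h x) (act h n) = act h (act x n).
Proof.
rewrite {1}/act conjE -[LHS]/(act h (act x (sym_inv (val h) (val h n)))).
by rewrite symK.
Qed.

Lemma conjM h k : conj (h * k) = conj h * conj k.
Proof.
apply: autP => x; apply: actP => n.
rewrite -[n](actVK (h * k)) act_conj; move: (act _ n) => m.
by rewrite autME !actM !act_conj.
Qed.

Lemma conj1 : conj 1 = 1.
Proof. by apply: (mulgI (conj 1)); rewrite -conjM !mulg1. Qed.

Lemma map_act_conj h x s :
  map (act h) s = s -> map (act (conj h x)) s = map (act h) (map (act x) s).
Proof.
move=> hs; rewrite -{1}hs -!map_comp; apply: eq_map => n /=.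
exact: act_conj.
Qed.

Lemma conj_coded_coset_sub h c :
  (forall n, n \in code_points c -> act h n = n) ->
  conj h @` coded_coset c `<=` coded_coset c.
Proof.
case: c => [[s u] ts] hc _ [z [g gs [t tts zs]] <-] /=.
have fixs r : {subset r <= code_points (s, u, ts)} -> map (act h) r = r.
  by move=> rc; rewrite -[RHS]map_id; apply/eq_in_map => n /rc/hc.
have hs : map (act h) s = s.
  by apply: fixs => n ns; rewrite /code_points !mem_cat ns.
have hu : map (act h) u = u.
  by apply: fixs => n nu; rewrite /code_points !mem_cat nu orbT.
have ht : map (act h) t = t.
  apply: fixs => n nt; rewrite /code_points !mem_cat.
  by apply/orP; right; apply/orP; right; apply/flattenP; exists t.
exists (conj h g); first by rewrite /= map_act_conj// gs.
by exists t => //=; rewrite !map_act_conj//= zs.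
Qed.

(** If k fixes all points occurring in a code, conjugation by k maps the coded coset into itself;
    k^-1 gives equality. *)
Lemma conj_continuous : continuous conj.
Proof.
move=> h A /aut_nbhsP[As oAs AA]; apply/nbhs_mulg1.
have : nbhs 1 [set k | forall B, B \in As -> conj k @` B = B].
  apply: filter_seq => B /oAs/(open_coset_codeP oligG)[c ->].
  have := open_pstab H (code_points c).
  rewrite openE => /(_ 1 (sg1 _)); apply: filterS => k kc.
  apply/seteqP; split; first exact: conj_coded_coset_sub.
  move=> z cz; exists (conj k^-1 z).
    by apply: (@conj_coded_coset_sub k^-1); [exact: (sgV kc)|exists z].
  by rewrite -autME -conjM mulgV conj1.
by apply: filterS => k kAs; rewrite /= conjM; exact: AA.
Qed.

End conjugation.

Lemma innerE g x : val (inner g x) = val g * val x * (val g)^-1.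
Proof. by []. Qed.

Lemma inner_converging_bounded (I : Type) (U : set_system I) (k : I -> S) f a :
  UltraFilter U -> (fun i => inner (k i)) @ U --> f ->
  exists b, U [set i | act (k i) a = b].
Proof.
move=> UU kf.
pose A := [set y : S | map (act y) [:: a] = map (act (1 : S)) [:: a]].
have UA : U [set i | inner (k i) @` A = f @` A].
  have : nbhs f [set f' : Aut S | f' @` A = f @` A]; last exact: kf.
  apply/aut_nbhsP; exists [:: A].
    by move=> B; rewrite inE => /eqP ->; exact: open_coset_pstab.
  move=> f' /(_ A (mem_head _ _)) f'A.
  by rewrite /= -[LHS]/((f \o f') @` A) -image_comp f'A.
have [j jA] := filter_ex UA.
have [s sP] := finite_fixed_points oligG a.
have [|b _ Ub] := @ultra_finite _ _ U (map (act (k j)) s)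
    (fun b => [set i | act (k i) a = b]) UU; last by exists b.
apply: filterS UA => i iA; exists (act (k i) a) => //.
apply/mapP; exists (act (k j)^-1 (act (k i) a)); last by rewrite actVK.
(* The conjugate of g in G_a by [k j] is the conjugate by [k i] of some g' in G_a, so it fixes (k i)
   a; hence g fixes (k j)^-1 (k i) a. *)
apply: sP => g ga.
have : (inner (k i) @` A) (inner (k j) g).
  by rewrite iA -jA; exists g => //=; rewrite /A /= ga.
move=> [g' [g'a] gg'].
apply: (@act_inj _ (k j)).
by rewrite -(act_conj innerE) actVK -gg' (act_conj innerE) g'a.
Qed.

Lemma closed_Inn : closed (sg_set G) -> closed (sg_set (Inn S)).
Proof.
move=> cG f cf.
pose F : set_system S := filter_from (nbhs f) (fun B => @inner S @^-1` B).
have PF : ProperFilter F.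
  apply: filter_from_proper => [|B /cf[_ [[g _ <-] Bg]]]; last by exists g.
  apply: filter_from_filter; first by exists setT; exact: filterT.
  by move=> B C nB nC; exists (B `&` C) => //; exact: filterI.
have [U [UU FU]] := ultraFilterLemma PF.
have Uf : (fun g => inner g) @ U --> f by move=> B nB; apply: FU; exists B.
(* The inverses also get a pointwise limit [l'], which makes [l] bijective. *)
have Uf' : (fun g => inner g^-1) @ U --> (f^-1 : Aut S).
  move=> B /invg_continuous /Uf UB.
  have {}UB : U [set g | B (inner g)^-1] by exact: UB.
  rewrite /= /nbhs /=; apply: filterS UB => g /=.
  rewrite (_ : inner g^-1 = (inner g)^-1)//.
  by apply: (mulgI (inner g)); rewrite -(conjM innerE) !mulgV (conj1 innerE).
have /boolp.choice[l lP] : forall a, exists b, U [set g : S | act g a = b].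
  by move=> a; exact: (inner_converging_bounded _ UU Uf).
have /boolp.choice[l' l'P] : forall a, exists b, U [set g : S | act g^-1 a = b].
  by move=> a; exact: (inner_converging_bounded _ UU Uf').
have lK : cancel l l'.
  move=> a; have [g [ga]] := filter_ex (filterI (lP a) (l'P (l a))).
  by rewrite /= -ga actK.
have l'K : cancel l' l.
  move=> a; have [g [ga]] := filter_ex (filterI (l'P a) (lP (l' a))).
  by rewrite /= -ga actVK.
have Us s : U [set g : S | forall n, n \in s -> act g n = l n].
  by apply: filter_seq => n _; exact: lP.
have /sub_act[g gl] : sg_set G (MkSym lK l'K).
  apply: sym_closedP cG _ _ => s.
  by have [g gs] := filter_ex (Us s); exists g.
exists g => //.
have Ug : U --> g.
  move=> B /act_nbhsP[s sB]; apply: filterS (Us s) => h hs.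
  by apply: sB => n ns; rewrite gl hs.
have hd := subgroup_base_hausdorff aut_base aut_separated.
have Ui : (fun h => inner h) @ U --> inner g.
  by move=> B /(conj_continuous innerE)/Ug.
exact: (cvg_unique hd Ui Uf).
Qed.

End automorphisms.

(** * The normaliser and the automorphisms it induces *)

Section normaliser.
Variable G : subgroup Sym.
Local Notation S := (set_type (sg_set G)).
Local Notation N := (set_type (sg_set (normaliser G))).
Implicit Types (x y z g : S) (h : N) (s t : seq nat).

Lemma normaliser_conj h x : sg_set G (val h * val x * (val h)^-1).
Proof.
have hG : [set g ^ (val h)^-1 | g in sg_set G] = sg_set G := mem_val h^-1.
suff : [set g ^ (val h)^-1 | g in sg_set G] (val h * val x * (val h)^-1).
  by rewrite hG.
by exists (val x); [exact: mem_val|rewrite conjgE invgK mulgA].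
Qed.

Lemma normaliserP (f : Sym) :
  (forall x, sg_set G (f * val x * f^-1)) ->
  (forall x, sg_set G (f^-1 * val x * f)) -> sg_set (normaliser G) f.
Proof.
move=> fG f'G; apply/seteqP; split=> [_ [x Gx <-]|x Gx].
  by have := f'G (SigSub (mem_set Gx)); rewrite conjgE mulgA.
exists (f * x * f^-1); first exact: (fG (SigSub (mem_set Gx))).
by rewrite conjgE !mulgA mulVg mul1g divgK.
Qed.

(** On a finite set, f x f^-1 and f^-1 x f depend on f at finitely many points. Some h in N_G agrees
    with f there, so both are limits of elements of the closed group G. *)
Lemma closed_normaliser :
  closed (sg_set G) -> closed (sg_set (normaliser G)).
Proof.
move=> cG; rewrite closedE => f fN.
have {}fN s : exists h, {in s, act h =1 f}.
  apply: contrapT => nex; apply: fN; apply/sym_nbhsP; exists s => g gf Ng.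
  by apply: nex; exists (SigSub (mem_set Ng)).
apply: normaliserP => x; apply: sym_closedP cG _ _ => s.
  have [h hf] := fN (map (sym_inv f) s ++ map (act x) (map (sym_inv f) s)).
  have [y yE] := sub_act (normaliser_conj h x); exists y => n ns.
  rewrite yE -[RHS]/(f (act x (sym_inv f n))).
  rewrite -[LHS]/(act h (act x (act h^-1 n))).
  have hn : act h (sym_inv f n) = n.
    by rewrite hf ?symVK// mem_cat map_f.
  rewrite -{1}hn actK hf// mem_cat; apply/orP; right.
  by apply: map_f; exact: map_f.
have [h hf] := fN (s ++ map (fun n => sym_inv f (act x (f n))) s).
have [y yE] := sub_act (normaliser_conj h^-1 x); exists y => n ns.
rewrite yE -[RHS]/(sym_inv f (act x (f n))).
rewrite -[LHS]/(act h^-1 (act x (sym_inv (sym_inverse (val h)) n))).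
rewrite -[sym_inv _ n]/(act h n) hf; last by rewrite mem_cat ns.
apply: (@act_inj _ h); rewrite actVK hf ?symVK// mem_cat.
by apply/orP; right; exact: map_f.
Qed.

Definition conj_fun h x : S := SigSub (mem_set (normaliser_conj h x)).

Let act_conj_fun h x n : act (conj_fun h x) n = act h (act x (act h^-1 n)).
Proof. by []. Qed.

Let conj_fun_continuous h : continuous (conj_fun h).
Proof.
move=> x A /act_nbhsP[s sA]; apply/act_nbhsP; exists (map (act h^-1) s) => y yx.
by apply: sA => n ns; rewrite !act_conj_fun yx// map_f.
Qed.

Program Definition normaliser_aut h : Aut S :=
  @MkAut S (conj_fun h) (conj_fun h^-1) _ _ _ _ _.
Next Obligation.
by move=> h x; apply: actP => n; rewrite !act_conj_fun invgK !(actK, actVK).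
Qed.
Next Obligation.
by move=> h x; apply: actP => n; rewrite !act_conj_fun invgK !(actK, actVK).
Qed.
Next Obligation.
by move=> h x y; apply: actP => n; rewrite !(actM, act_conj_fun) actK.
Qed.
Next Obligation. by move=> h; exact: conj_fun_continuous. Qed.
Next Obligation. by move=> h; exact: conj_fun_continuous. Qed.

Lemma normaliser_autE h x :
  val (normaliser_aut h x) = val h * val x * (val h)^-1.
Proof. by []. Qed.

Hypothesis oligG : oligomorphic G.

Let stab n : set S := sg_set (pstab G [:: orep G n]).

(** With c(n) in G taking [orep G n] to n, the permutation sends n to f(c(n)) applied to
    [orep G n]. *)
Lemma perm_of_aut (f : Aut S) :
  (forall n, f @` stab n = stab n) ->
  exists h, normaliser_aut h = f.
Proof.
move=> fstab.
have [c cE] : {c : nat -> S | forall n, act (c n) (orep G n) = n}.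
  by have [c cE] := boolp.choice (@orepP G); exists c.
pose perm (f : Aut S) n := act (f (c n)) (orep G n).
have permE (f0 : Aut S) :
    (forall n, f0 @` stab n `<=` stab n) ->
    forall x n, perm f0 (act x n) = act (f0 x) (perm f0 n).
  move=> f0stab x n; rewrite /perm -actM -autM orep_act.
  apply: (@act_inj _ (f0 (c (act x n)))^-1); rewrite actK -actM.
  rewrite -autV -autM; apply/esym.
  (* c(x n)^-1 x c(n) fixes the orbit representative, and [f0] maps its stabiliser into itself. *)
  suff : stab n (f0 ((c (act x n))^-1 * (x * c n))).
    by move/pstabP; apply; exact: mem_head.
  apply: f0stab; exists ((c (act x n))^-1 * (x * c n)) => //;
    apply/pstabP => m; rewrite inE => /eqP ->.
  by rewrite actM actM cE -{2}(cE (act x n)) orep_act actK.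
have fV n : aut_inv f @` stab n = stab n.
  by rewrite -[in LHS](fstab n) aut_invK.
have perm_orep (f0 : Aut S) n :
    f0 @` stab n = stab n ->
    perm f0 (orep G n) = orep G n.
  move=> f0stab; rewrite /perm orep_idem.
  suff : stab n (f0 (c (orep G n))).
    by move/pstabP; apply; exact: mem_head.
  rewrite -f0stab; exists (c (orep G n)) => //;
    apply/pstabP => m; rewrite inE => /eqP ->.
  by rewrite -{2}[orep G n]orep_idem cE.
have permK (f0 : Aut S) :
    (forall n, f0 @` stab n = stab n) ->
    cancel (perm f0) (perm f0^-1).
  move=> f0stab n.
  have f0V m : aut_inv f0 @` stab m = stab m
    by rewrite -[in LHS]f0stab aut_invK.
  (* The permutation of the inverse is equivariant and fixes representatives, so it sends f0(c(n))
     [orep G n] to c(n) [orep G n], which is n. *)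
  rewrite {2}/perm permE; last by move=> m; rewrite -[X in _ `<=` X]f0V.
  by rewrite autKg perm_orep ?cE.
have pK := permK f fstab.
have pVK : cancel (perm f^-1) (perm f).
  by have := permK f^-1 fV; rewrite invgK.
have fsub n : f @` stab n `<=` stab n.
  by rewrite fstab.
have fVsub n : aut_inv f @` stab n `<=` stab n by rewrite fV.
have Np : sg_set (normaliser G) (MkSym pK pVK).
  apply: normaliserP => x.
    rewrite (_ : _ * _ = val (f x)); first exact: mem_val.
    apply: symP => n; rewrite -[LHS]/(perm f (act x (perm f^-1 n))).
    by rewrite permE// pVK.
  rewrite (_ : _ * _ = val (aut_inv f x)); first exact: mem_val.
  apply: symP => n; rewrite -[LHS]/(perm f^-1 (act x (perm f n))).
  by rewrite permE// pK.
have [h hE] := sub_act Np; exists h.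
apply: autP => x; apply: actP => n.
rewrite -[n](actVK h); move: (act _ n) => m.
by rewrite (act_conj normaliser_autE) !hE /= permE.
Qed.

End normaliser.

(** * Compactness in N_G/G and in Out(G) *)

Section quotients.
Variable G : subgroup Sym.
Hypotheses (oligG : oligomorphic G) (closedG : closed (sg_set G)).
Local Notation S := (set_type (sg_set G)).
Local Notation N := (set_type (sg_set (normaliser G))).
Local Notation Q := (normaliser_quotient G).
Implicit Types (x y z g : S) (h : N) (s t : seq nat).

Lemma nbhs1_normaliser_aut : nbhs 1 (range (@normaliser_aut G)).
Proof.
have [s sP] := finite_orep oligG.
apply/aut_nbhsP; exists [seq sg_set (pstab G [:: a]) | a <- s].
  move=> _ /mapP[a _ ->]; exists (pstab G [:: a]), 1.
  split; first exact: open_pstab.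
  by rewrite -[LHS]image_id; apply: eq_imagel => y _; rewrite mul1g.
move=> f fs; rewrite mul1g.
have [n|h <-] := perm_of_aut (f := f); last by exists h.
by apply: fs; exact: map_f.
Qed.

(** Passing from h to g h stays in h G because G is normal in N_G. *)
Lemma normaliser_mulE (h : N) g : exists h', act h' =1 act g \o act h /\
  @to_coset N (in_normaliser G) h' = to_coset (in_normaliser G) h.
Proof.
have Ng : sg_set (normaliser G) (val g).
  apply: normaliserP => x.
    by have := mem_val (g * x * g^-1).
  by have := mem_val (g^-1 * x * g).
pose k : N := SigSub (mem_set Ng).
exists (k * h); split => //; apply/cosetP.
have : sg_set (in_normaliser G) (k^-1 ^ h).
  by apply: nsg_normal; apply: sgV; exact: mem_val g.
by rewrite conjgE invgM mulgA.
Qed.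

Section back_and_forth.
Variable U : set_system Q.
Hypothesis UU : UltraFilter U.

(* The elements g * repr a, with g in G, are all representatives of the coset a
   of G. The pairs in p form a finite partial map, induced by one of these
   representatives for U-almost every a. *)
Definition ultra_orbit (p : seq (nat * nat)) : Prop :=
  U [set a | exists g, forall q, q \in p -> act g (act (repr a : N) q.1) = q.2].

Lemma ultra_orbit_sub p p' :
  {subset p' <= p} -> ultra_orbit p -> ultra_orbit p'.
Proof.
move=> pp'; apply: filterS => a [g gp]; exists g => q /pp'; exact: gp.
Qed.

Lemma ultra_orbit_inj p c d c' d' : ultra_orbit p ->
  (c, d) \in p -> (c', d') \in p -> c = c' <-> d = d'.
Proof.
move=> /filter_ex[a [g gp]] /gp /= <- /gp /= <-; split=> [->//|].
by move=> /act_inj /act_inj.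
Qed.

(** Up to elements of G fixing the values of [p], there are finitely many candidates for the image
    of c; the ultrafilter picks one. *)
Lemma ultra_orbit_forth p c :
  ultra_orbit p -> exists d, ultra_orbit ((c, d) :: p).
Proof.
move=> Up.
have [_ [d _ <-]|L LP PL] := finite_transversal oligG (n := (size p).+1)
    (P := range (fun d => d :: [seq q.2 | q <- p])).
  by rewrite /= size_map.
have [|d _ Ud] := @ultra_finite _ _ U (map (head 0) L)
  (fun d => [set a | exists g, forall q, q \in (c, d) :: p ->
     act g (act (repr a : N) q.1) = q.2]) UU; last by exists d.
apply: filterS Up => a [g gp].
have [_ /[dup]/LP[d _ <-] Ld [g' [g'd g'p]]] :=
  PL _ (imageT _ (act g (act (repr a : N) c))).
exists d; first by apply/mapP; exists (d :: [seq q.2 | q <- p]).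
exists (g' * g) => q; rewrite in_cons => /predU1P[->|pq] /=.
  by rewrite actM.
rewrite actM gp//; move: g'p; rewrite -map_comp => /eq_in_map; exact.
Qed.

(** The candidates for the preimage of d are finitely many up to elements of G fixing the sources of
    [p]. *)
Lemma ultra_orbit_back p d :
  ultra_orbit p -> exists c, ultra_orbit ((c, d) :: p).
Proof.
move=> Up.
have [_ [c _ <-]|L LP PL] := finite_transversal oligG (n := (size p).+1)
    (P := range (fun c => c :: [seq q.1 | q <- p])).
  by rewrite /= size_map.
have [|c _ Uc] := @ultra_finite _ _ U (map (head 0) L)
  (fun c => [set a | exists g, forall q, q \in (c, d) :: p ->
     act g (act (repr a : N) q.1) = q.2]) UU; last by exists c.
apply: filterS Up => a [g gp]; set h := repr a in gp *.
have [_ /[dup]/LP[c _ <-] Lc [g' [g'c g'p]]] :=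
  PL _ (imageT _ (act h^-1 (act g^-1 d))).
exists c; first by apply/mapP; exists (c :: [seq q.1 | q <- p]).
(* g' acts on the sources, before h; conjugating its inverse by h moves it to the left of h, inside
   G. *)
exists (g * conj_fun h g'^-1) => q.
rewrite actM (act_conj (@normaliser_autE G)) in_cons => /predU1P[->|pq] /=.
  by rewrite -g'c actK !actVK.
rewrite (_ : act g'^-1 q.1 = q.1) ?gp//.
move: g'p; rewrite -map_comp => /eq_in_map/(_ q pq) /= {1}<-.
by rewrite actK.
Qed.

Lemma ultra_orbit_limit : exists f : Sym,
  forall s, ultra_orbit [seq (n, f n) | n <- s].
Proof.
have [next nextP] : {next : nat -> seq (nat * nat) -> seq (nat * nat) |
  forall n p, ultra_orbit p ->
  [/\ ultra_orbit (next n p), {subset p <= next n p},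
    exists d, (n, d) \in next n p & exists c, (c, n) \in next n p]}.
  apply/cid.
  have /boolp.choice[next nextP] : forall np : nat * seq (nat * nat), exists p',
      ultra_orbit np.2 -> [/\ ultra_orbit p', {subset np.2 <= p'},
      exists d, (np.1, d) \in p' & exists c, (c, np.1) \in p'].
    move=> [n p]; have [Up|] := pselect (ultra_orbit p); last by exists p.
    have [d Ud] := ultra_orbit_forth n Up.
    have [c Uc] := ultra_orbit_back n Ud.
    exists ((c, n) :: (n, d) :: p) => _; split => //=.
    - by move=> q qp; rewrite !in_cons qp !orbT.
    - by exists d; rewrite !in_cons eqxx orbT.
    - by exists c; rewrite in_cons eqxx.
  by exists (fun n p => next (n, p)) => n p /(nextP (n, p)).
(* Stage k + 1 puts k into both the domain and the range of the partial map. *)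
pose st := fix st k := if k is k'.+1 then next k' (st k') else [::].
have Ust k : ultra_orbit (st k).
  elim: k => [|k /(nextP k)[]//]; apply: filterS filterT => a _.
  by exists 1.
have sub_st k k' : (k <= k')%N -> {subset st k <= st k'}.
  elim: k' => [|k' IH]; first by rewrite leqn0 => /eqP ->.
  rewrite leq_eqVlt => /predU1P[->//|]; rewrite ltnS => /IH kk' q /kk'.
  by have [_ + _ _] := nextP k' _ (Ust k'); apply.
(* Any two pairs occur in a common stage, which is a partial injection. *)
have st_inj k k' c d c' d' :
    (c, d) \in st k -> (c', d') \in st k' -> c = c' <-> d = d'.
  move=> /(sub_st _ _ (leq_maxl k k')) cd /(sub_st _ _ (leq_maxr k k')) cd'.
  exact: ultra_orbit_inj (Ust _) cd cd'.
have /boolp.choice[f fP] : forall n, exists d, (n, d) \in st n.+1.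
  by move=> n; have [_ _] := nextP n _ (Ust n).
have /boolp.choice[f' f'P] : forall n, exists c, (c, n) \in st n.+1.
  by move=> n; have [_ _ _] := nextP n _ (Ust n).
have fK : cancel f f'.
  by move=> n; apply/(st_inj _ _ _ _ _ _ (f'P (f n)) (fP n)).
have f'K : cancel f' f.
  by move=> n; apply/(st_inj _ _ _ _ _ _ (fP (f' n)) (f'P n)).
exists (MkSym fK f'K) => s.
apply: ultra_orbit_sub (Ust (\max_(n <- s) n).+1) => _ /mapP[n ns ->].
apply: sub_st (fP n); rewrite ltnS; exact: leq_bigmax_seq.
Qed.

End back_and_forth.

Lemma compact_normaliser_quotient : compact [set: Q].
Proof.
rewrite compact_ultra => U UU _.
have [f fP] := ultra_orbit_limit UU.
have /sub_act[h hf] : sg_set (normaliser G) f.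
  apply: sym_closedP (closed_normaliser closedG) _ _ => s.
  have [a [g gs]] := filter_ex (fP s).
  have [h [hE _]] := normaliser_mulE (repr a) g.
  by exists h => n ns; rewrite hE /= (gs _ (map_f _ ns)).
exists (to_coset (in_normaliser G) h); split => // A.
(* Almost every coset has a representative that agrees with h on [s], and so lies in [A]. *)
move=> /coset_continuous/act_nbhsP[s sA].
apply: filterS (fP s) => a [g gs].
have [h' [h'E h'a]] := normaliser_mulE (repr a) g.
rewrite -[a]coset_repr -h'a; apply: sA => n ns.
by rewrite h'E hf /= (gs _ (map_f _ ns)).
Qed.

Lemma closed_in_normaliser : closed (sg_set (in_normaliser G)).
Proof.
have /closed_comp :
    {in ~` sg_set (in_normaliser G), continuous (val : N -> Sym)}.
  by move=> h _; exact: initial_continuous.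
exact.
Qed.

Lemma nbhs1_compact_Out :
  exists2 K : set (Out S), nbhs 1 K & compact K.
Proof.
pose q h : Out S := to_coset (Inn S) (normaliser_aut h).
have qc : continuous q.
  move=> h; apply: (@continuous_comp _ _ _ (@normaliser_aut G)).
    exact: (conj_continuous oligG (@normaliser_autE G)).
  exact: coset_continuous.
exists (range q).
  have := coset_nbhs (Inn S) nbhs1_normaliser_aut.
  by rewrite image_comp.
have qE h h' : to_coset (in_normaliser G) h = to_coset (in_normaliser G) h' ->
    q h = q h'.
  move=> /cosetP hh'; have Gh : sg_set G (val (h^-1 * h')) := hh'.
  apply/cosetP; exists (SigSub (mem_set Gh)) => //.
  apply: (mulgI (normaliser_aut h)).
  rewrite mulVKg.
  rewrite -[in RHS](mulVKg h h') (conjM (@normaliser_autE G)).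
  by congr (_ * _); apply: autP => x; apply: actP.
(* As [q] is constant on cosets of G, its range is a continuous image of the compact N_G/G. *)
rewrite (_ : range q = (q \o repr) @` [set: Q]); last first.
  apply/seteqP; split=> [_ [h _ <-]|_ [a _ <-]]; last by exists (repr a).
  exists (to_coset _ h) => //=; apply: qE; exact: coset_repr.
apply: continuous_compact compact_normaliser_quotient.
apply: continuous_subspaceT; apply: repr_comp_continuous => // h h' /eqP hh'.
exact/eqP/qE.
Qed.

End quotients.

Theorem theorem1p1 (R : realType) (G : subgroup Sym)
    (closedG : closed (sg_set G)) (oligomorphicG : oligomorphic G) :
  let NG_G := normaliser_quotient G in
  let OutG := Out (set_type G) in
  [/\ closed (sg_set (Inn (set_type G))),
      polish R NG_G /\ profinite NG_G &
      [/\ polish R OutG, totally_disconnected [set: OutG] &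
          locally_compact [set: OutG]]].
Proof.
have cI := closed_Inn oligomorphicG closedG.
have baseN := coset_subgroup_base (in_normaliser G) (pstab_base (normaliser G)).
have sepN := coset_subgroup_separated (pstab_base (normaliser G))
  (closed_in_normaliser closedG).
have baseO := coset_subgroup_base (Inn (set_type G)) (aut_base oligomorphicG).
have sepO := coset_subgroup_separated (aut_base oligomorphicG) cI.
have cN := compact_normaliser_quotient oligomorphicG closedG.
have [K K1 cK] := nbhs1_compact_Out oligomorphicG closedG.
split => //; split.
(* N_G/G is its own compact neighbourhood of 1. *)
- apply: (subgroup_base_polish R sepN baseN _ filterT cN).
  exact/coset_separable/act_separable.
- split => //; first exact: subgroup_base_hausdorff baseN sepN.
  exact: subgroup_base_totally_disconnected baseN sepN.
- apply: (subgroup_base_polish R sepO baseO _ K1 cK).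
  exact/coset_separable/aut_separable.
- exact: subgroup_base_totally_disconnected baseO sepO.
- exact: (subgroup_base_locally_compact baseO K1 cK).
Qed.
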